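(* There exists a constant $c>0$ such that for every integer $k\geq 2$ and every graph $G$ with $\operatorname{tw}(G)\geq ck^4\log^{5/2}(k)$, we have $\operatorname{tw}(G\times K_2)\geq k$.
   Context: $\operatorname{tw}$ denotes treewidth. The direct product $G \times H$ has vertex set $V(G)\times V(H)$, with $(a,v)(b,u)$ an edge iff $ab\in E(G)$ and $uv\in E(H)$; $K_2$ is the graph with two adjacent vertices. *)

(* Defs.v *)
From mathcomp Require Import all_boot.
From Stdlib Require Import ClassicalEpsilon.
Set Implicit Arguments. Unset Strict Implicit. Unset Printing Implicit Defensive.

(* Finite simple graphs are given by a finType V and a symmetric,
   irreflexive relation e : rel V. *)

(* A (finite) tree: symmetric irreflexive relation, nonempty, connected,
   with exactly #|I| - 1 edges (each edge counted twice as ordered pairs). *)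
Definition is_tree (I : finType) (t : rel I) : Prop :=
  [/\ symmetric t, irreflexive t, 0 < #|I|,
      (forall x y, connect t x y) &
      #|[set p : I * I | t p.1 p.2]| = 2 * (#|I| - 1)].

Definition tree_decomp (V : finType) (e : rel V)
    (I : finType) (t : rel I) (B : I -> {set V}) : Prop :=
  [/\ is_tree t,
      (forall v, exists i, v \in B i),
      (forall u v, e u v -> exists i, (u \in B i) && (v \in B i)) &
      (forall v i j, v \in B i -> v \in B j ->
         connect (fun a b => [&& t a b, v \in B a & v \in B b]) i j)].

Definition td_width (V I : finType) (B : I -> {set V}) : nat :=
  (\max_(i : I) #|B i|).-1.

Definition has_td_of_width (V : finType) (e : rel V) (n : nat) : Prop :=
  exists (I : finType) (t : rel I) (B : I -> {set V}),
    tree_decomp e t B /\ td_width B = n.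

Definition has_td_of_widthb (V : finType) (e : rel V) (n : nat) : bool :=
  if excluded_middle_informative (has_td_of_width e n) then true else false.

Lemma has_td_of_width_ex (V : finType) (e : rel V) :
  exists n, has_td_of_widthb e n.
Proof.
exists (td_width (fun _ : unit => [set: V])).
rewrite /has_td_of_widthb; case: excluded_middle_informative => // H; exfalso.
apply: H; exists unit, (fun _ _ => false), (fun _ => [set: V]).
split=> //; split.
- split; rewrite ?card_unit //=.
    by case; case; rewrite connect0.
  apply/eqP; rewrite cards_eq0; apply/eqP/setP => p.
  by rewrite !inE.
- by move=> v; exists tt; rewrite inE.
- by move=> u v _; exists tt; rewrite !inE.
- by move=> v [] [] _ _; rewrite connect0.
Qed.

Definition treewidth (V : finType) (e : rel V) : nat :=
  ex_minn (has_td_of_width_ex e).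

Definition dprod_rel (V W : finType) (e : rel V) (f : rel W) : rel (V * W) :=
  fun p q => e p.1 q.1 && f p.2 q.2.

Definition K2_rel : rel bool := fun a b => a != b.

(* Main.v *)
Require Import Defs.
From mathcomp Require Import all_boot zify.
From Stdlib Require Import Reals Lra.
(* The bound is in fact linear: tw(G) > 8k implies tw(G x K2) >= k.
   If tw(G) > 8k, repeated splitting along balanced separators must fail, so
   some set W has the property that for every Y with at most 2k vertices some
   component beta(Y) of G - Y contains more than half of W; these components
   pairwise intersect.  If beta(Y) is non-bipartite whenever |Y| <= k, each
   beta(Y) lifts to a connected subset of G x K2, and beta composed with the
   projection to G is a haven there.  Otherwise some beta(Y0) is bipartite, so
   G x K2 contains a copy of it, and the sets beta(Y0 u Y) with |Y| <= k lie in
   beta(Y0) and give a haven in that copy.  A haven of pairwise intersecting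
   connected sets avoiding all sets of size k forces treewidth at least k. *)

Set Implicit Arguments. Unset Strict Implicit. Unset Printing Implicit Defensive.

(** * Paths and rooted trees *)

Lemma connect_closed (T : finType) (R : rel T) (Q : T -> Prop) :
  (forall x y, R x y -> Q x -> Q y) ->
  forall x y, connect R x y -> Q x -> Q y.
Proof.
move=> cl x y /connectP[s]; elim: s x => [|z s IH] x /=; first by move=> _ ->.
by case/andP=> Rxz pzs lasty Qx; apply: IH pzs lasty (cl _ _ Rxz Qx).
Qed.

(** Making the root its own parent lets [p] be iterated freely. [d] is any measure dropping strictly
    toward the root, which excludes cycles. *)
Definition rooted (I : finType) (r : I) (p : I -> I) (d : I -> nat) : Prop :=
  p r = r /\ (forall x, x != r -> d (p x) < d x).

Definition parent_rel (I : finType) (r : I) (p : I -> I) : rel I :=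
  fun x y => (x != r) && (y == p x) || (y != r) && (x == p y).

Section RootedTrees.
Variables (I : finType) (r : I) (p : I -> I) (d : I -> nat).
Hypothesis rtd : rooted r p d.

Lemma rooted_parent_neq x : x != r -> p x != x.
Proof. by move=> xr; apply/eqP => px; have := rtd.2 x xr; rewrite px ltnn. Qed.

Lemma parent_rel_sym : symmetric (parent_rel r p).
Proof. by move=> x y; rewrite /parent_rel orbC. Qed.

Lemma card_parent_rel :
  #|[set q : I * I | parent_rel r p q.1 q.2]| = 2 * (#|I| - 1).
Proof.
pose up := [set (x, p x) | x in [set~ r]].
pose down := [set (p x, x) | x in [set~ r]].
have -> : [set q : I * I | parent_rel r p q.1 q.2] = up :|: down.
  apply/setP=> -[x y]; rewrite !inE /=; apply/idP/idP.
    case/orP=> /andP[xr /eqP ->]; apply/orP; [left|right].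
      by apply/imsetP; exists x; rewrite ?inE.
    by apply/imsetP; exists y; rewrite ?inE.
  by case/orP=> /imsetP[z]; rewrite !inE => zr [-> ->];
    rewrite /parent_rel zr eqxx ?orbT.
have card0 : #|[set~ r]| = #|I| - 1 by rewrite cardsC1 subn1.
rewrite cardsU !card_imset ?card0; try by [move=> x y [] | move=> x y []].
suff -> : up :&: down = set0 by rewrite cards0 subn0 mul2n addnn.
apply/setP=> -[x y]; rewrite !inE; apply/negbTE/negP.
case/andP=> /imsetP[u]; rewrite !inE => ur [-> ->].
case/imsetP=> v; rewrite !inE => vr [uE vE].
by have := rtd.2 u ur; have := rtd.2 v vr; rewrite -uE vE; lia.
Qed.

Lemma rooted_is_tree : is_tree (parent_rel r p).
Proof.
have to_root x : connect (parent_rel r p) x r.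
  have [n] := ubnP (d x); elim: n x => // n IH x dx.
  case: (eqVneq x r) => [->|xr]; first exact: connect0.
  apply: (connect_trans (y := p x)); last by apply: IH; have := rtd.2 x xr; lia.
  by apply: connect1; rewrite /parent_rel xr eqxx.
split.
- exact: parent_rel_sym.
- move=> x; rewrite /parent_rel orbb; apply/andP=> -[xr].
  by rewrite eq_sym (negbTE (rooted_parent_neq xr)).
- by apply/card_gt0P; exists r.
- move=> x y; apply: connect_trans (to_root x) _.
  by rewrite (sym_connect_sym parent_rel_sym).
- exact: card_parent_rel.
Qed.

Definition ancestor (a j : I) : Prop := exists n, iter n p j = a.

Lemma ancestor_trans b a j : ancestor a b -> ancestor b j -> ancestor a j.
Proof. by move=> [n <-] [m <-]; exists (n + m); rewrite iterD. Qed.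

Lemma ancestor_total a b j :
  ancestor a j -> ancestor b j -> ancestor a b \/ ancestor b a.
Proof.
move=> [n <-] [m <-]; case: (leqP n m) => h.
  by right; exists (m - n); rewrite -iterD subnK.
by left; exists (n - m); rewrite -iterD subnK // ltnW.
Qed.

Lemma ancestor_depth a j : ancestor a j -> a = j \/ d a < d j.
Proof.
move=> [n <-]; elim: n => [|n IH]; first by left.
rewrite iterS; case: (eqVneq (iter n p j) r) => [E|nr].
  by rewrite E rtd.1 -E.
by right; have := rtd.2 _ nr; case: IH => [->|] //; lia.
Qed.

End RootedTrees.

(** Take distance to an arbitrary [r] as depth and a closer neighbour as parent. Parent edges are
    tree edges, and both sets have size [2 * (#|I| - 1)], so they coincide. *)
Lemma tree_rooted (I : finType) (t : rel I) : is_tree t ->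
  exists r p d, rooted r p d /\ (forall x y, t x y -> parent_rel r p x y).
Proof.
case=> tS tI /card_gt0P[r _] tC tE.
have exd x : exists n, [exists s : n.-tuple I, path t x s && (last x s == r)].
  case/connectP: (tC x r) => s ps rE; exists (size s); apply/existsP.
  by exists (in_tuple s); rewrite ps /= -rE eqxx.
pose d x := ex_minn (exd x).
have closer x : x != r -> exists y, t x y && (d y < d x).
  move=> xr; rewrite /d; case: (ex_minnP (exd x)) => n.
  case/existsP=> -[[|y s] sz] /andP[ps /eqP rE] _.
    by rewrite -rE eqxx in xr.
  move: ps rE; rewrite /= => /andP[txy ps] rE; exists y; rewrite txy /=.
  case: ex_minnP => m _ min; have /min : [exists s' : (size s).-tuple I,
      path t y s' && (last y s' == r)].
    by apply/existsP; exists (in_tuple s); rewrite ps /= rE eqxx.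
  by rewrite -(eqP sz) ltnS.
pose p x := if x == r then r else odflt x [pick y | t x y && (d y < d x)].
have pP x : x != r -> t x (p x) && (d (p x) < d x).
  move=> xr; rewrite /p (negbTE xr); case: pickP => //= none.
  by case: (closer x xr) => y; rewrite none.
have rt : rooted r p d.
  by split; [rewrite /p eqxx | move=> x /pP/andP[]].
exists r, p, d; split=> // x y txy.
have sub : [set q : I * I | parent_rel r p q.1 q.2] \subset
           [set q : I * I | t q.1 q.2].
  apply/subsetP=> -[u v]; rewrite !inE /=.
  case/orP=> /andP[/pP/andP[tu _] /eqP->]; first by [].
  by rewrite tS.
have /eqP E : [set q : I * I | parent_rel r p q.1 q.2] ==
              [set q : I * I | t q.1 q.2].
  by rewrite eqEcard sub tE (card_parent_rel rt) leqnn.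
by have := in_set (fun q : I * I => t q.1 q.2) (x, y);
   rewrite -E inE /= txy.
Qed.

(** * Treewidth bounds and havens *)

Definition restrict (V : finType) (e : rel V) (D : {set V}) : rel V :=
  fun a b => [&& e a b, a \in D & b \in D].

Definition connected_set (V : finType) (e : rel V) (D : {set V}) : Prop :=
  forall x y, x \in D -> y \in D -> connect (restrict e D) x y.

Lemma restrict_sym (V : finType) (e : rel V) (D : {set V}) :
  symmetric e -> symmetric (restrict e D).
Proof. by move=> eS x y; rewrite /restrict eS [X in _ && X]andbC. Qed.

Lemma treewidth_le (V : finType) (e : rel V) (I : finType) (t : rel I)
    (B : I -> {set V}) n :
  tree_decomp e t B -> (forall i, #|B i| <= n) -> treewidth e <= n.
Proof.
move=> td Bn; rewrite /treewidth; case: ex_minnP => m _ min.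
have hw : has_td_of_widthb e (td_width B).
  rewrite /has_td_of_widthb.
  by case: ClassicalEpsilon.excluded_middle_informative => // -[]; exists I, t, B.
apply: leq_trans (min _ hw) _; apply: leq_trans (leq_pred _) _.
exact/bigmax_leqP.
Qed.

(** The minus one in the width matters here: width below [k] means bags of size at most [k], exactly
    the sets on which a haven is defined. *)
Lemma treewidth_ge (V : finType) (e : rel V) k :
  (forall (I : finType) (t : rel I) (B : I -> {set V}),
     tree_decomp e t B -> ~ (forall i, #|B i| <= k)) ->
  k <= treewidth e.
Proof.
move=> H; rewrite /treewidth; case: ex_minnP => n.
rewrite /has_td_of_widthb.
case: ClassicalEpsilon.excluded_middle_informative => // -[I [t [B [td wn]]]] _ _.
rewrite leqNgt; apply/negP => nk; apply: (H _ _ _ td) => i.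
have := leq_bigmax (F := fun i => #|B i|) i; move: wn; rewrite /td_width; lia.
Qed.

(** Let [a] have least depth among the bags containing [v]. Walking away from [a] through such bags,
    a step up shortens the chain back to [a] and a step down lengthens it; a step up from [a] itself
    would contradict minimality. *)
Lemma tree_decomp_top (V : finType) (e : rel V) (I : finType) (t : rel I)
    (B : I -> {set V}) r p d :
  tree_decomp e t B -> rooted r p d ->
  (forall x y, t x y -> parent_rel r p x y) ->
  forall v, exists a, v \in B a /\ forall j, v \in B j ->
    exists n, iter n p j = a /\ forall m, m <= n -> v \in B (iter m p j).
Proof.
case=> _ cov _ con rt tp v; have [i0 vi0] := cov v.
case: (@arg_minnP _ i0 (fun i => v \in B i) d vi0) => a va amin; exists a; split=> // j vj.
have := con v a j va vj.
move/(@connect_closed _ _ (fun j => exists n, iter n p j = a /\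
  forall m, m <= n -> v \in B (iter m p j))); apply; last first.
  by exists 0; split=> // m; rewrite leqn0 => /eqP->.
move=> x y /and3P[/tp txy vx vy] [n [na nB]].
case/orP: txy => /andP[zr /eqP E].
- case: n na nB => [|n] na nB.
    have := amin _ vy; have := rt.2 _ zr; rewrite -E -na /=; lia.
  exists n; rewrite E -iterSr; split=> // m mn.
  by rewrite -iterSr; apply: nB.
- exists n.+1; rewrite iterSr -E; split=> // -[|m] mn //.
  by rewrite iterSr -E; apply: nB.
Qed.

(* The deepest of the topmost bags meeting the sets [beta X] meets all of them. *)
Lemma treewidth_ge_haven (V : finType) (e : rel V) k
    (beta : {set V} -> {set V}) :
  (forall X : {set V}, #|X| <= k -> [disjoint beta X & X]) ->
  (forall X : {set V}, #|X| <= k -> connected_set e (beta X)) ->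
  (forall X Y : {set V}, #|X| <= k -> #|Y| <= k ->
     exists x, x \in beta X :&: beta Y) ->
  k <= treewidth e.
Proof.
move=> dis con int; apply: treewidth_ge => I t B td Bk.
have [r [p [d [rt tp]]]] : exists r p d, rooted r p d /\
    (forall x y, t x y -> parent_rel r p x y) by case: td => /tree_rooted.
have [top topP] := fin_all_exists (tree_decomp_top td rt tp).
have topA v j : v \in B j -> ancestor p (top v) j.
  by case/((topP v).2) => n [<- _]; exists n.
have edge u v : e u v -> exists2 j, u \in B j & v \in B j.
  by case: td => _ _ H _ /H[j /andP[]]; exists j.
have k0 : #|@set0 V| <= k by rewrite cards0.
(* The size bound sits under the existential so that a choice function on all sets can be extracted;
   an oversized [X] gets an arbitrary vertex. *)
have least (X : {set V}) : exists v, #|X| <= k ->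
    v \in beta X /\ forall u, u \in beta X -> d (top v) <= d (top u).
  case: (leqP #|X| k) => Xk; last by have [v _] := int _ _ k0 k0; exists v.
  have [x] := int X X Xk Xk; rewrite setIid => xX.
  by case: (@arg_minnP _ x (fun u => u \in beta X) (fun u => d (top u)) xX) => v vX vmin; exists v.
have [low lowP] := fin_all_exists least.
case: (@arg_maxnP _ set0 (fun X : {set V} => #|X| <= k)
  (fun X => d (top (low X))) k0) => X Xk Xmax.
set a := top (low X) in Xmax.
have [lowX lowmin] := lowP X Xk.
(* Adjacent vertices share a bag, so [a] and the next top are comparable; minimality of [low X]
   rules out a top strictly above [a]. *)
have ancD x : x \in beta X -> ancestor p a (top x).
  move=> xX; apply: (@connect_closed _ _ (fun x => ancestor p a (top x)) _ _ _ (con X Xk _ _ lowX xX)); last by exists 0.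
  move=> u v /and3P[/edge[j uj vj] _ vX] au.
  have aj := ancestor_trans au (topA _ _ uj).
  case: (ancestor_total aj (topA _ _ vj)) => // /(ancestor_depth rt).
  by case=> [->|]; [exists 0 | have := lowmin v vX; rewrite -/a; lia].
(* [beta Y] avoids the bag at [a] but meets [beta X], hence has a vertex with top below [a]. Being
   connected, it cannot leave the subtree below [a] without using a vertex of that bag. *)
pose Y := B a; have Yk : #|Y| <= k := Bk a.
have [x] := int X Y Xk Yk; rewrite inE => /andP[xX xY].
have [lowY _] := lowP Y Yk.
have notB y : y \in beta Y -> y \notin B a.
  by move=> yY; rewrite (disjointFr (dis Y Yk) yY).
have : ancestor p a (top (low Y)).
  apply: (@connect_closed _ _ (fun x => ancestor p a (top x)) _ _ _ (con Y Yk _ _ xY lowY) (ancD _ xX)).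
  move=> u v /and3P[/edge[j uj vj] _ vY] au.
  have [n na] := ancestor_trans au (topA _ _ uj).
  have [m [ma mB]] := (topP v).2 _ vj.
  case: (leqP n m) => nm; first by have := notB _ vY; rewrite -na mB.
  by exists (n - m); rewrite -ma -iterD subnK // ltnW.
(* By the maximal choice of [X] the top of [low Y] cannot be deeper than [a], so it is [a], and
   [low Y] lies in the forbidden bag. *)
case/(ancestor_depth rt) => [E|]; last by have := Xmax Y Yk; rewrite -/a; lia.
by have := notB _ lowY; rewrite E (topP _).1.
Qed.

(** * Rooted decompositions *)

(* A tree decomposition of the subgraph induced on [U], as a rooted tree whose
   root bag contains [W].  [rd_top] is the local form of the requirement that
   the bags containing a given vertex form a subtree. *)
Record rdecomp (V : finType) (e : rel V) (U W : {set V}) (n : nat) := RDecomp {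
  rd_node : finType;
  rd_root : rd_node;
  rd_parent : rd_node -> rd_node;
  rd_depth : rd_node -> nat;
  rd_bag : rd_node -> {set V};
  rd_rooted : rooted rd_root rd_parent rd_depth;
  rd_cover : forall v, v \in U -> exists i, v \in rd_bag i;
  rd_edge : forall u v, u \in U -> v \in U -> e u v ->
    exists i, (u \in rd_bag i) && (v \in rd_bag i);
  rd_sub : forall i, rd_bag i \subset U;
  rd_subroot : W \subset rd_bag rd_root;
  rd_card : forall i, #|rd_bag i| <= n;
  rd_top : forall v i j, v \in rd_bag i -> v \in rd_bag j ->
    (i == rd_root) || (v \notin rd_bag (rd_parent i)) ->
    (j == rd_root) || (v \notin rd_bag (rd_parent j)) -> i = j }.

(** Climbing from a bag while the parent still contains [v] ends at a topmost bag; [rd_top] makes it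
    unique, so all bags containing [v] are joined through it. *)
Lemma rdecomp_treewidth (V : finType) (e : rel V) (W : {set V}) n :
  rdecomp e setT W n -> treewidth e <= n.
Proof.
case=> I r p d B rt cov edg _ _ Bn top.
apply: (@treewidth_le _ _ I (parent_rel r p) B) => //; split.
- exact: rooted_is_tree rt.
- by move=> v; apply: cov; rewrite inE.
- by move=> u v; apply: edg; rewrite inE.
move=> v; set R := fun a b => _.
have RS : symmetric R.
  by move=> a b; rewrite /R parent_rel_sym [X in _ && X]andbC.
have up i : v \in B i -> exists j, [/\ v \in B j,
    (j == r) || (v \notin B (p j)) & connect R i j].
  have [m] := ubnP (d i); elim: m i => // m IH i dm vi.
  case: (boolP ((i == r) || (v \notin B (p i)))) => [it|].
    by exists i; split=> //; exact: connect0.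
  rewrite negb_or negbK => /andP[ir vp].
  have [|j [vj jt cj]] := IH (p i) _ vp; first by have := rt.2 _ ir; lia.
  exists j; split=> //; apply: connect_trans cj; apply: connect1.
  by rewrite /R vi vp /parent_rel ir eqxx.
move=> i j /up[i' [vi' ti' ci]] /up[j' [vj' tj' cj]].
rewrite (top v i' j' vi' vj' ti' tj') in ci.
by apply: connect_trans ci _; rewrite (sym_connect_sym RS).
Qed.

(** * Components and balanced separators *)

Definition avoiding (V : finType) (e : rel V) (Y : {set V}) : rel V :=
  restrict e (~: Y).

(* The component of [G - Y] with canonical representative [c]; it is empty when
   [c] is not a representative. *)
Definition component (V : finType) (e : rel V) (Y : {set V}) (c : V) : {set V} :=
  [set x | (x \notin Y) && (root (avoiding e Y) x == c)].

Section Components.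
Variables (V : finType) (e : rel V).
Hypothesis eS : symmetric e.

Lemma avoiding_connect_sym Y : connect_sym (avoiding e Y).
Proof. exact/sym_connect_sym/restrict_sym. Qed.

Lemma component_step Y c x y :
  e x y -> x \in component e Y c -> y \notin Y -> y \in component e Y c.
Proof.
move=> exy; rewrite !inE => /andP[xY /eqP <-] yY; rewrite yY /=.
rewrite (root_connect (avoiding_connect_sym Y)) (avoiding_connect_sym Y).
by apply: connect1; rewrite /avoiding /restrict exy !inE xY.
Qed.

Lemma component_connected Y c : connected_set e (component e Y c).
Proof.
move=> x y xC yC.
have xy : connect (avoiding e Y) x y.
  move: xC yC; rewrite !inE => /andP[_ /eqP xc] /andP[_ /eqP yc].
  by rewrite -(root_connect (avoiding_connect_sym Y)) xc yc.
suff [] : y \in component e Y c /\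
  connect (restrict e (component e Y c)) x y by [].
apply: (@connect_closed _ _ (fun z => z \in component e Y c /\
  connect (restrict e (component e Y c)) x z) _ _ _ xy) => //.
move=> u v /and3P[euv uY vY] [uC xu].
have vC : v \in component e Y c.
  by apply: component_step euv uC _; move: vY; rewrite inE.
by split=> //; apply: connect_trans xu (connect1 _); rewrite /restrict euv uC.
Qed.

Lemma component_mono (Y Z : {set V}) c c' : Y \subset Z ->
  (exists x, x \in component e Z c :&: component e Y c') ->
  component e Z c \subset component e Y c'.
Proof.
move=> YZ [x]; rewrite inE => /andP[xZ xY]; apply/subsetP=> y yZ.
have /(@connect_closed _ _ (fun z => z \in component e Y c')) :=
  component_connected xZ yZ.
apply=> // u v /and3P[euv _ vZ] uY; apply: component_step euv uY _.
by move: vZ; rewrite inE => /andP[vZ _]; apply: contra vZ; apply: subsetP.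
Qed.

(** The pieces hang below a new root [None] with bag [R]. No edge joins different components of
    [G - Y], and pieces overlap only in [Y :&: U], which lies in [R] and in every piece's root
    bag. *)
Lemma rdecomp_glue (U W Y : {set V}) n :
  W \subset U -> #|W :|: (Y :&: U)| <= n ->
  (forall c, rdecomp e (U :&: (component e Y c :|: Y))
     ((component e Y c :&: W) :|: (Y :&: U)) n) ->
  rdecomp e U W n.
Proof.
move=> WU Rn D; pose R := W :|: (Y :&: U).
pose I : finType := option {c : V & rd_node (D c)}.
pose inn c (x : rd_node (D c)) : I := Some (Tagged (fun c => rd_node (D c)) x).
pose p (i : I) : I := match i with
  | None => None
  | Some u => if tagged u == rd_root (D (tag u)) then None
              else inn _ (rd_parent (tagged u)) end.
pose d (i : I) := if i is Some u then (rd_depth (tagged u)).+1 else 0.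
pose B (i : I) := if i is Some u then rd_bag (tagged u) else R.
have inU c v (x : rd_node (D c)) : v \in rd_bag x ->
    (v \in U) && ((v \in component e Y c) || (v \in Y)).
  by move/(subsetP (rd_sub x)); rewrite inE in_setU.
have outR c v (x : rd_node (D c)) : v \in rd_bag x -> v \in R ->
    v \in rd_bag (rd_root (D c)).
  move=> vx vR; apply: (subsetP (rd_subroot (D c))).
  move: vR (inU _ _ _ vx); rewrite !in_setU !in_setI => vR /andP[vU].
  rewrite vU !andbT in vR *.
  by case: (v \in Y) vR => [|]; rewrite ?orbT // !orbF => -> ->.
apply: (@RDecomp _ _ _ _ _ I None p d B).
- split=> // -[[c x]|] // _ /=; case: eqVneq => //= xr.
  by rewrite ltnS; apply: (rd_rooted (D c)).2.
- move=> v vU; case: (boolP (v \in Y)) => vY.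
    by exists None; rewrite /= !inE vY vU orbT.
  have [x vx] : exists x, v \in rd_bag (r := D (root (avoiding e Y) v)) x.
    by apply: rd_cover; rewrite !inE vU vY eqxx.
  by exists (inn _ x).
- have side u v : u \in U -> v \in U -> e u v -> u \notin Y ->
      exists i, (u \in B i) && (v \in B i).
    move=> uU vU euv uY; pose c := root (avoiding e Y) u.
    have uc : u \in component e Y c by rewrite inE uY eqxx.
    have [||x xuv] := @rd_edge _ _ _ _ _ (D c) u v _ _ euv.
    + by rewrite inE in_setU uU uc.
    + rewrite inE in_setU vU /=; case: (boolP (v \in Y)) => vY; first by rewrite orbT.
      by rewrite (component_step euv uc vY).
    by exists (inn _ x).
  move=> u v uU vU euv; case: (boolP (u \in Y)) => uY; last exact: side.
  case: (boolP (v \in Y)) => vY.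
    by exists None; rewrite /= !in_setU !in_setI uY vY uU vU !orbT.
  have [|i] := side v u vU uU _ vY; first by rewrite eS.
  by rewrite andbC; exists i.
- case=> [[c x]|] /=; first exact: subset_trans (rd_sub x) (subsetIl _ _).
  by rewrite subUset WU subsetIr.
- exact: subsetUl.
- by case=> [[c x]|] //=; exact: rd_card.
(* A vertex of [R] occurring in a piece is in that piece's root bag by [outR], so its topmost bag is
   [None]. A vertex outside [R] is outside [Y], and its component determines the piece. *)
- have topin v c (x : rd_node (D c)) : v \in rd_bag x ->
      (inn c x == None) || (v \notin B (p (inn c x))) ->
      v \notin R /\ ((x == rd_root (D c)) || (v \notin rd_bag (rd_parent x))).
    move=> vx /=; case: eqVneq => [//|xr /= vp]; split=> //.
    apply: contra vp => vR; have vr := outR _ _ _ vx vR.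
    case: (boolP (v \in rd_bag (rd_parent x))) => // nvp.
    by case/eqP: xr; apply: (rd_top vx vr); rewrite ?nvp ?eqxx ?orbT.
  have inside v c (x : rd_node (D c)) : v \in rd_bag x -> v \notin R ->
      c = root (avoiding e Y) v.
    move=> /inU/andP[vU]; rewrite !inE vU andbT => /orP[/andP[_ /eqP->]//|->].
    by rewrite orbT.
  move=> v [[c x]|] [[c' x']|] /= vx vx' tx tx' //.
  + have [nR tx1] := topin _ _ _ vx tx; have [_ tx2] := topin _ _ _ vx' tx'.
    have E := inside _ _ _ vx nR; have E' := inside _ _ _ vx' nR.
    rewrite -E in E'; move: x' vx' tx2 {tx'}; rewrite E' => x' vx' tx2.
    by rewrite (rd_top vx vx' tx1 tx2).
  + by have [] := topin _ _ _ vx tx; rewrite vx'.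
  + by have [] := topin _ _ _ vx' tx'; rewrite vx.
Qed.

(** If [U] is large, [W] is enlarged to exactly [3 * w] vertices and [U] is split along [sep W]. The
    root bag has at most [3w + w] vertices, and each piece inherits a boundary of at most
    [3w/2 + w < 3w]. *)
Lemma rdecomp_separators w (sep : {set V} -> {set V}) :
  0 < w ->
  (forall W : {set V}, #|W| = 3 * w -> #|sep W| <= w /\
     forall c, 2 * #|component e (sep W) c :&: W| <= 3 * w) ->
  forall U W : {set V}, W \subset U -> #|W| <= 3 * w -> rdecomp e U W (4 * w).
Proof.
(* Enlarging [W] lowers the second summand; splitting lowers the first without raising the
   second. *)
move=> w0 sepP U W; have [m] := ubnP (#|U| + #|U :\: W|).
elim: m U W => // m IH U W mm WU Ww.
case: (leqP #|U| (4 * w)) => Uw.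
  apply: (@RDecomp _ _ _ _ _ unit tt (fun i => i) (fun=> 0) (fun=> U)) => //.
  - by move=> u v uU vU _; exists tt; rewrite uU.
  - by move=> v [] [].
case: (ltnP #|W| (3 * w)) => Ww'.
  have /set0Pn/sigW[x] : U :\: W != set0.
    by rewrite -card_gt0 cardsDS //; lia.
  rewrite inE => /andP[xW xU].
  have [|||I r p d B h1 h2 h3 h4 h5 h6 h7] := IH U (x |: W).
  - have : U :\: (x |: W) \proper U :\: W.
      rewrite properE setDS ?subsetUr //=; apply/subsetPn; exists x;
      by rewrite !inE ?eqxx ?xW.
    by move/proper_card; lia.
  - by rewrite subUset sub1set xU.
  - by rewrite cardsU1 xW; lia.
  exists I r p d B => //; apply: subset_trans h5; exact: subsetUr.
have {Ww Ww'} Wc : #|W| = 3 * w by lia.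
have [Yw Yc] := sepP W Wc; set Y := sep W in Yw Yc.
have YUw : #|Y :&: U| <= w by apply: leq_trans Yw; apply/subset_leq_card/subsetIl.
apply: (@rdecomp_glue U W Y) => // [|c].
  by have := cardsU W (Y :&: U); lia.
set Wc' := _ :|: (Y :&: U).
have Wcw : #|Wc'| < 3 * w.
  by have := cardsU (component e Y c :&: W) (Y :&: U); have := Yc c; rewrite -/Wc'; lia.
set Uc := U :&: _.
have sub1 : Wc' \subset Uc.
  apply/subsetP=> x; rewrite !in_setU !in_setI in_setU.
  by case/orP=> /andP[h1 h2]; [rewrite (subsetP WU) ?h1 | rewrite h1 h2 orbT].
apply: IH => //; last exact: ltnW.
(* If the piece were all of [U], its boundary [Wc'] would contain [W], which is larger. *)
have UcU : #|Uc| < #|U|.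
  apply: proper_card; rewrite properE subsetIl /=; apply/negP => UUc.
  suff /subset_leq_card : W \subset Wc' by lia.
  apply/subsetP=> x xW; have xU := subsetP WU _ xW.
  have := subsetP UUc _ xU; rewrite !in_setU !in_setI in_setU xU xW /= !andbT.
  by [].
suff /subset_leq_card : Uc :\: Wc' \subset U :\: W by lia.
apply/subsetP=> x; rewrite !in_setD !in_setU !in_setI in_setU.
case/andP=> h /andP[xU hx]; rewrite xU andbT; apply/negP=> xW.
by move: h; rewrite xU xW !andbT hx.
Qed.

End Components.

(** If every [W] had a balanced separator of size at most [w], the recursion started at [W = set0]
    would give treewidth at most [4 * w]. *)
Lemma large_treewidth_component (V : finType) (e : rel V) w :
  symmetric e -> 0 < w -> 4 * w < treewidth e ->
  exists W : {set V}, forall Y : {set V}, #|Y| <= w ->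
    exists c, #|W| < 2 * #|component e Y c :&: W|.
Proof.
move=> eS w0 tw.
pose good (W Y : {set V}) := (#|Y| <= w) &&
  [forall c, 2 * #|component e Y c :&: W| <= #|W|].
case: (boolP [exists W : {set V}, [forall Y, ~~ good W Y]]) => [|none].
  case/existsP=> W /forallP bad; exists W => Y Yw.
  move: (bad Y); rewrite /good Yw negb_forall => /existsP[c].
  by rewrite -ltnNge; exists c.
have sepP (W : {set V}) : #|W| = 3 * w ->
    #|odflt set0 [pick Y | good W Y]| <= w /\
    forall c, 2 * #|component e (odflt set0 [pick Y | good W Y]) c :&: W| <= 3 * w.
  move=> <-; case: pickP => [Y /andP[Yw /forallP Yc] //|bad].
  case/existsP: none; exists W; apply/forallP=> Y; by rewrite bad.
have W0 : #|@set0 V| <= 3 * w by rewrite cards0.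
have := rdecomp_treewidth (rdecomp_separators eS w0 sepP (sub0set setT) W0).
by rewrite leqNgt tw.
Qed.

(** * Lifting to the double cover *)

Lemma connected_set_imset (V V' : finType) (e : rel V) (e' : rel V')
    (h : V -> V') (D : {set V}) :
  (forall u v, u \in D -> v \in D -> e u v -> e' (h u) (h v)) ->
  connected_set e D -> connected_set e' (h @: D).
Proof.
move=> hom con _ _ /imsetP[x xD ->] /imsetP[y yD ->].
apply: (@connect_closed _ _ (fun z => connect (restrict e' (h @: D)) (h x) (h z))
  _ _ _ (con _ _ xD yD)) => // u v /and3P[euv uD vD] xu.
apply: connect_trans xu (connect1 _).
by rewrite /restrict hom ?imset_f.
Qed.

Lemma dprod_K2_sym (V : finType) (e : rel V) :
  symmetric e -> symmetric (dprod_rel e K2_rel).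
Proof. by move=> eS p q; rewrite /dprod_rel /K2_rel eS eq_sym. Qed.

(* If the two lifts of some vertex are joined inside the lift of [C], then the
   lift is connected; otherwise reachability of a layer properly 2-colours [C]. *)
Lemma lift_connected_or_bipartite (V : finType) (e : rel V) (C : {set V}) :
  symmetric e -> connected_set e C ->
  connected_set (dprod_rel e K2_rel) (setX C [set: bool]) \/
  exists col : V -> bool,
    forall u v, u \in C -> v \in C -> e u v -> col u != col v.
Proof.
move=> eS con; set L := setX C _; pose R := restrict (dprod_rel e K2_rel) L.
have RS : connect_sym R by exact/sym_connect_sym/restrict_sym/dprod_K2_sym.
have edge u v b : u \in C -> v \in C -> e u v -> connect R (u, b) (v, ~~ b).
  move=> uC vC euv; apply: connect1.
  rewrite /R /restrict /dprod_rel /K2_rel /= euv !inE /= uC vC.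
  by case: b.
have lift x y b : x \in C -> y \in C -> exists b', connect R (x, b) (y, b').
  move=> xC yC; apply: (@connect_closed _ _
    (fun z => exists b', connect R (x, b) (z, b')) _ _ _ (con _ _ xC yC)).
    move=> u v /and3P[euv uC vC] [b' xu]; exists (~~ b').
    exact: connect_trans xu (edge _ _ _ uC vC euv).
  by exists b; exact: connect0.
(* Exchanging the layers is an automorphism of the lift. *)
have swap x b y b' : connect R (x, b) (y, b') -> connect R (x, ~~ b) (y, ~~ b').
  move/(@connect_closed _ _ (fun q => connect R (x, ~~ b) (q.1, ~~ q.2))); apply.
    move=> [u a] [v a'] /and3P[/andP[/= euv aa'] uL vL] xu.
    have [uC vC] : u \in C /\ v \in C by move: uL vL; rewrite !inE !andbT.
    have -> : a' = ~~ a by move: aa'; rewrite /K2_rel /=; case: a a' {xu uL vL} => -[].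
    exact: connect_trans xu (edge _ _ _ uC vC euv).
  exact: connect0.
case: (set_0Vmem C) => [C0|[x0 x0C]].
  by left=> -[x b] y; rewrite in_setX C0 inE.
case: (boolP (connect R (x0, false) (x0, true))) => [join|apart]; [left|right].
  have base y b : y \in C -> connect R (x0, false) (y, b).
    move=> yC; have [b' yb'] := lift _ x0 b yC x0C.
    rewrite RS; apply: connect_trans yb' _.
    by case: b'; [rewrite RS | exact: connect0].
  move=> [x b] [y b']; rewrite !in_setX => /andP[xC _] /andP[yC _].
  by apply: connect_trans (base y b' yC); rewrite -/R RS; exact: base.
exists (fun v => connect R (x0, false) (v, true)) => u v uC vC euv.
(* Equal colours on an edge make both lifts of [u] reachable from [(x0, false)]; swapping one of
   these connections joins the two lifts of [x0]. *)
apply: contraNneq apart => uv.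
have [b ub] := lift x0 u false x0C uC; case: b ub => ub.
  move: uv; rewrite ub => /esym vt.
  have /swap uf := connect_trans vt (edge v u true vC uC (etrans (eS _ _) euv)).
  by apply: connect_trans ub _; rewrite RS.
have vt := connect_trans ub (edge u v false uC vC euv).
move/swap: ub => ub; apply: connect_trans (etrans uv vt) _.
by rewrite RS.
Qed.

Lemma treewidth_double_cover (V : finType) (e : rel V) k :
  symmetric e -> 0 < k -> 8 * k < treewidth e ->
  k <= treewidth (dprod_rel e K2_rel).
Proof.
move=> eS k0 tw.
(* The size [2 * k] leaves room for [Y0 :|: pr X], a union of two sets of size at most [k]; this is
   where [8 * k = 4 * (2 * k)] comes from. *)
have [||W WP] := @large_treewidth_component _ _ (2 * k) eS; [lia|lia|].
have total (Y : {set V}) : exists c, #|Y| <= 2 * k ->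
    #|W| < 2 * #|component e Y c :&: W|.
  case: (leqP #|Y| (2 * k)) => [/WP[c]|Yk]; first by exists c.
  by have [|c _] := WP set0; [rewrite cards0 | exists c].
have [rep repP] := fin_all_exists total.
pose beta Y := component e Y (rep Y).
(* Two subsets of [W], each with more than half of it, intersect. *)
have meet (Y Z : {set V}) : #|Y| <= 2 * k -> #|Z| <= 2 * k ->
    exists x, x \in beta Y :&: beta Z.
  move=> /repP hY /repP hZ; apply/set0Pn; apply/eqP=> YZ0.
  have := cardsUI (beta Y :&: W) (beta Z :&: W).
  rewrite setIACA YZ0 set0I cards0 -setIUl.
  have := subset_leq_card (subsetIr (beta Y :|: beta Z) W).
  by rewrite -/(beta Y) -/(beta Z) in hY hZ *; lia.
pose pr (X : {set V * bool}) : {set V} := [set q.1 | q in X].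
have prk X : #|pr X| <= #|X| by exact: leq_imset_card.
case: (Classical_Prop.classic (exists Y0 : {set V}, #|Y0| <= k /\
  exists col : V -> bool, forall u v, u \in beta Y0 -> v \in beta Y0 ->
    e u v -> col u != col v)) => [[Y0 [Y0k [col colP]]]|nobip].
  have small (X : {set V * bool}) : #|X| <= k -> #|Y0 :|: pr X| <= 2 * k.
    by have := cardsU Y0 (pr X); have := prk X; lia.
  have Y0k2 : #|Y0| <= 2 * k by lia.
  (* A proper colouring [col] makes [v] to [(v, col v)] preserve edges inside [beta Y0], which
     contains every [beta (Y0 :|: pr X)]. *)
  apply: (@treewidth_ge_haven _ _ _
    (fun X => [set (v, col v) | v in beta (Y0 :|: pr X)])) => [X Xk|X Xk|X Z Xk Zk].
  - rewrite disjoint_subset; apply/subsetP=> q /imsetP[v vB ->]; rewrite inE.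
    apply/negP=> vX; move: vB; rewrite !inE negb_or => /andP[/andP[_ /imsetP[]]].
    by exists (v, col v).
  - apply: connected_set_imset (component_connected eS (c := _)) => u v uB vB euv.
    have /subsetP sub : beta (Y0 :|: pr X) \subset beta Y0.
      by apply: component_mono (subsetUl _ _) (meet _ _ (small _ Xk) Y0k2).
    by rewrite /dprod_rel /K2_rel /= euv colP ?sub.
  - have [x] := meet _ _ (small X Xk) (small Z Zk); rewrite inE => /andP[xX xZ].
    by exists (x, col x); rewrite inE !imset_f.
apply: (@treewidth_ge_haven _ _ _ (fun X => setX (beta (pr X)) [set: bool]))
  => [X Xk|X Xk|X Z Xk Zk].
- rewrite disjoint_subset; apply/subsetP=> -[v b].
  rewrite in_setX !inE andbT => /andP[vX _]; apply: contra vX => vX.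
  by apply/imsetP; exists (v, b).
- have [//|[col colP]] := lift_connected_or_bipartite eS
    (@component_connected _ _ eS (pr X) (rep (pr X))).
  case: nobip; exists (pr X); split; first exact: leq_trans (prk X) Xk.
  by exists col.
- have [||x] := meet (pr X) (pr Z); [have := prk X; lia|have := prk Z; lia|].
  rewrite inE => /andP[xX xZ].
  by exists (x, true); rewrite inE !in_setX xX xZ !inE.
Qed.

Theorem mainTheorem15 :
  exists c : R, (0 < c)%R /\
    forall (k : nat), (2 <= k)%N ->
    forall (V : finType) (e : rel V), symmetric e -> irreflexive e ->
      (c * (INR k ^ 4) * Rpower (ln (INR k)) (5 / 2) <= INR (treewidth e))%R ->
      (k <= treewidth (dprod_rel e K2_rel))%N.
Proof.
(* For [k >= 2], [k^4 >= 8k]; also [ln k > 1/2], so its power [5/2] is at least [(1/2)^3 = 1/8].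
   Thus [16] gives at least [16k], above the required [8k]. *)
exists 16%R; split; first by lra.
move=> k k2 V e eS _ tw; apply: treewidth_double_cover => //; first by lia.
have K2 : (2 <= INR k)%R by have := le_INR 2 k (leP k2); rewrite /=; lra.
have lnk : (/ 2 < ln (INR k))%R.
  apply: Rlt_le_trans ln_lt_2 _; case: (Rle_lt_or_eq_dec _ _ K2) => [lt2|<-].
    by apply/Rlt_le/ln_increasing; lra.
  exact: Rle_refl.
have pow : (/ 8 <= Rpower (ln (INR k)) (5 / 2))%R.
  have -> : (/ 8 = Rpower (/ 2) (INR 3))%R.
    by rewrite Rpower_pow /=; [field | lra].
  apply: (Rle_trans _ (Rpower (/ 2) (5 / 2))).
    rewrite /Rpower; apply/Rlt_le/exp_increasing.
    by have := ln_lt_2; rewrite ln_Rinv /=; [nra | lra].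
  by apply: Rle_Rpower_l; lra.
have k4 : (8 * INR k <= INR k ^ 4)%R.
  have sq : (4 <= INR k * INR k)%R by nra.
  have cube : (8 <= INR k * INR k * INR k)%R by nra.
  by rewrite /=; nra.
have : (8 * INR k < INR (treewidth e))%R.
  apply: Rlt_le_trans tw; nra.
have -> : (8 * INR k = INR (8 * k))%R by rewrite mult_INR /=; ring.
by move/INR_lt/ltP.
Qed.
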